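(* Let $n\ge1$ be an integer, let $1\le p_1,p_2\le\infty$ and $\frac1p=\frac1{p_1}+\frac1{p_2}$. If $p\le\frac{n}{2n-1}$, then the bilinear spherical maximal operator $\mathcal M$ is unbounded from $L^{p_1}(\mathbb R^n)\times L^{p_2}(\mathbb R^n)$ to $L^p(\mathbb R^n)$. In particular, when $n=1$, $\mathcal M$ is unbounded from $L^2(\mathbb R)\times L^2(\mathbb R)$ to $L^1(\mathbb R)$.
   Context: For Schwartz functions $f,g$ on $\mathbb R^n$, the bi(sub)linear spherical maximal function is $$\mathcal M(f,g)(x)=\sup_{t>0}\Big|\int_{\mathbb S^{2n-1}} f(x-ty)\,g(x-tz)\,d\sigma(y,z)\Big|,\qquad x\in\mathbb R^n,$$ where $\mathbb S^{2n-1}=\{(y,z)\in\mathbb R^n\times\mathbb R^n: |y|^2+|z|^2=1\}$ and $\sigma$ is surface measure on $\mathbb S^{2n-1}$. ''Unbounded from $L^{p_1}\times L^{p_2}$ to $L^p$'' means that there is no finite constant $C$ such that $\|\mathcal M(f,g)\|_{L^p}\le C\|f\|_{L^{p_1}}\|g\|_{L^{p_2}}$ for all Schwartz functions $f,g$ on $\mathbb R^n$. Here $1/\infty=0$, and for $p<1$, $\|\cdot\|_{L^p}$ is the usual quasi-norm. *)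

(* Defs.v *)
From HB Require Import structures.
From mathcomp Require Export all_boot all_order all_algebra.
From mathcomp Require Export all_classical all_reals all_analysis.
From mathcomp Require Export measurable_realfun complex.

Set Implicit Arguments.
Unset Strict Implicit.
Unset Printing Implicit Defensive.

Import Order.TTheory GRing.Theory Num.Theory.
Import numFieldNormedType.Exports.
Import ComplexField.Normc.

Local Open Scope classical_set_scope.
Local Open Scope ring_scope.
Local Open Scope complex_scope.

(* 'rV[R]_n carries the sigma-algebra generated by its coordinates, i.e. the  *)
(* product (equivalently, the Borel) sigma-algebra of R^n.                    *)
Fact rV_display : measure_display. Proof. exact: default_measure_display. Qed.

Section measurable_rV.
Context {R : realType} (n : nat).

Let coors : 'I_n -> 'rV[R]_n -> R := fun i x => x ord0 i.

Let rV_set0 : g_sigma_preimage coors set0.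
Proof. exact: sigma_algebra0. Qed.

Let rV_setC A : g_sigma_preimage coors A -> g_sigma_preimage coors (~` A).
Proof. exact: sigma_algebraC. Qed.

Let rV_bigcup (F : _^nat) : (forall i, g_sigma_preimage coors (F i)) ->
  g_sigma_preimage coors (\bigcup_i (F i)).
Proof. exact: sigma_algebra_bigcup. Qed.

HB.instance Definition _ := @isMeasurable.Build rV_display
  'rV[R]_n (g_sigma_preimage coors) rV_set0 rV_setC rV_bigcup.

Lemma measurable_coord (i : 'I_n) :
  measurable_fun [set: 'rV[R]_n] (fun x => x ord0 i).
Proof.
move=> _ Y mY; rewrite setTI; apply: sub_sigma_algebra => /=.
rewrite -bigcup_seq/=; exists i => /=; first by rewrite mem_index_enum.
by exists Y => //; rewrite setTI.
Qed.

Lemma measurable_fun_rV d (T : measurableType d) (f : T -> 'rV[R]_n) :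
  (forall i, measurable_fun [set: T] (fun t => f t ord0 i)) ->
  measurable_fun [set: T] f.
Proof.
move=> mf.
have S : g_sigma_preimage (fun i => coors i \o f) `<=` measurable.
  apply: smallest_sub; first exact: sigma_algebra_measurable.
  rewrite -bigcup_seq => A [i _ [B mB <-]]; exact: mf.
rewrite g_sigma_preimage_comp in S.
by move=> _ A mA; apply: S; exists A.
Qed.

End measurable_rV.

Section lebesgue_measure_rV.
Context {R : realType}.

Definition cons_rV n (p : measurableTypeR R * 'rV[R]_n) : 'rV[R]_n.+1 :=
  \row_j oapp (p.2 ord0) p.1 (unlift ord0 j).

Definition uncons_rV n (x : 'rV[R]_n.+1) : measurableTypeR R * 'rV[R]_n :=
  (x ord0 ord0, \row_j x ord0 (lift ord0 j)).

Lemma cons_rVK n : cancel (@cons_rV n) (@uncons_rV n).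
Proof.
move=> [a x]; congr pair; first by rewrite mxE unlift_none.
by apply/rowP => j; rewrite !mxE liftK.
Qed.

Lemma measurable_cons_rV n : measurable_fun setT (@cons_rV n).
Proof.
apply: measurable_fun_rV => i.
under eq_fun do rewrite mxE.
case: unliftP => [j _|_] /=; last exact: measurable_fst.
exact: (measurableT_comp (measurable_coord j) measurable_snd).
Qed.

Lemma measurable_uncons_rV n : measurable_fun setT (@uncons_rV n).
Proof.
apply: measurable_fun_pair; first exact: measurable_coord.
apply: measurable_fun_rV => i.
by under eq_fun do rewrite mxE; exact: measurable_coord.
Qed.

Section step.
Context n (m : {sigma_finite_measure set 'rV[R]_n -> \bar R}).

Definition lebesgue_step : set 'rV[R]_n.+1 -> \bar R :=
  pushforward (@lebesgue_measure R \x m)%E (@cons_rV n).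

Let mcons := @measurable_cons_rV n.

Let lebesgue_step0 : lebesgue_step set0 = 0%E.
Proof. exact: measure0. Qed.

Let lebesgue_step_ge0 A : (0 <= lebesgue_step A)%E.
Proof. exact: measure_ge0. Qed.

Let lebesgue_step_sigma_additive : semi_sigma_additive lebesgue_step.
Proof. exact: measure_semi_sigma_additive. Qed.

HB.instance Definition _ := isMeasure.Build _ _ _ lebesgue_step
  lebesgue_step0 lebesgue_step_ge0 lebesgue_step_sigma_additive.

(* Proved by hand: the sigma-finite instance of \x is shadowed in the library by *)
(* the one for subprobabilities.                                              *)
Let lebesgue_step_sigma_finite : sigma_finite setT lebesgue_step.
Proof.
have /sigma_finiteP[F [TF ndF Foo]] := sigma_finiteT (@lebesgue_measure R).
have /sigma_finiteP[G [TG ndG Goo]] := sigma_finiteT m.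
exists (fun k => @uncons_rV n @^-1` (F k `*` G k)).
  rewrite -preimage_bigcup; apply/esym/seteqP; split=> // x _ /=.
  have [[i _ Fi] [j _ Gj]] : (\bigcup_k F k) (uncons_rV x).1 /\
    (\bigcup_k G k) (uncons_rV x).2 by rewrite -TF -TG.
  exists (maxn i j) => //; split.
    exact: (subsetPset _ _ (ndF _ _ (leq_maxl i j))).
  exact: (subsetPset _ _ (ndG _ _ (leq_maxr i j))).
move=> k; have [[mF Fk] [mG Gk]] := (Foo k, Goo k); split.
  rewrite -[X in measurable X]setTI.
  by apply: measurable_uncons_rV => //; exact: measurableX.
rewrite /lebesgue_step /pushforward -comp_preimage.
rewrite (_ : _ \o _ = id); last by apply/funext => p /=; rewrite cons_rVK.
by rewrite preimage_id product_measure1E// lte_mul_pinfty// ge0_fin_numE.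
Qed.

HB.instance Definition _ := Measure_isSigmaFinite.Build _ _ _ lebesgue_step
  lebesgue_step_sigma_finite.

End step.

(* Lebesgue measure on R^n: the n-fold product of the Lebesgue measure of R,  *)
(* along R^(n+1) = R x R^n.                                                   *)
Fixpoint lebesgue_measure_rV n : {sigma_finite_measure set 'rV[R]_n -> \bar R} :=
  match n with
  | 0 => @dirac _ 'rV[R]_0 0 R
  | n.+1 => lebesgue_step (lebesgue_measure_rV n)
  end.

End lebesgue_measure_rV.

Section sphere.
Context {R : realType} (n : nat).
Local Notation Rn := 'rV[R]_n.

(* The elements of R^(2n) = R^n x R^n are pairs. The library norm on 'rV[R]_n  *)
(* is the sup norm, so the Euclidean one is spelled out.                      *)
Definition sqnorm (w : Rn * Rn) : R :=
  \sum_(i < n) w.1 ord0 i ^+ 2 + \sum_(i < n) w.2 ord0 i ^+ 2.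

Definition sphere : set (Rn * Rn)%type := [set w | sqnorm w = 1].

(* Surface measure via polar coordinates: sigma(A) is 2n (the dimension of the *)
(* ambient space) times the Lebesgue measure of { r v | 0 < r <= 1, v in A }. *)
Definition sphere_cone (A : set (Rn * Rn)%type) : set (Rn * Rn)%type :=
  [set (rw.1 *: rw.2.1, rw.1 *: rw.2.2) | rw in `]0, 1] `*` (A `&` sphere)].

Definition surface_measure (A : set (Rn * Rn)%type) : \bar R :=
  ((2 * n%:R)%:E *
   (lebesgue_measure_rV n \x lebesgue_measure_rV n) (sphere_cone A))%E.

Let N (w : Rn * Rn) : R := sqnorm w.
Let nrm (w : Rn * Rn) : Rn * Rn :=
  (N w `^ (- 2^-1) *: w.1, N w `^ (- 2^-1) *: w.2).

Let measurable_N : measurable_fun setT N.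
Proof.
apply: measurable_funD; apply: measurable_sum => i; apply: measurable_funX.
  exact: (measurableT_comp (measurable_coord i) measurable_fst).
exact: (measurableT_comp (measurable_coord i) measurable_snd).
Qed.

Let measurable_nrm : measurable_fun setT nrm.
Proof.
have mp : measurable_fun setT (fun w => N w `^ (- 2^-1)).
  exact: (measurableT_comp (measurable_powR (- 2^-1)) measurable_N).
apply: measurable_fun_pair; apply: measurable_fun_rV => i;
  under eq_fun do rewrite mxE; apply: measurable_funM => //.
  exact: (measurableT_comp (measurable_coord i) measurable_fst).
exact: (measurableT_comp (measurable_coord i) measurable_snd).
Qed.

Let sqnormZ r (w : Rn * Rn) : sqnorm (r *: w.1, r *: w.2) = r ^+ 2 * sqnorm w.
Proof.
rewrite /sqnorm mulrDr !mulr_sumr/=.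
by congr (_ + _); apply: eq_bigr => i _; rewrite mxE exprMn.
Qed.

Let sqnorm_nrm w : 0 < N w -> sqnorm (nrm w) = 1.
Proof.
move=> N0; rewrite sqnormZ -powR_mulrn ?powR_ge0// -powRrM.
by rewrite mulNr mulVf// powR_inv1 ?ltW// mulVf// gt_eqF.
Qed.

Lemma sphere_coneE A : sphere_cone A = N @^-1` `]0, 1] `&` nrm @^-1` A.
Proof.
apply/seteqP; split=> [_ [[r w] /= [+ [Aw w1]] <-]|w [/=]].
  rewrite in_itv/= => /andP[r0 r1].
  have NE : N (r *: w.1, r *: w.2) = r ^+ 2 by rewrite /N sqnormZ w1 mulr1.
  split => /=.
    by rewrite in_itv/= NE exprn_gt0//=; apply: exprn_ile1 => //; exact: ltW.
  rewrite /nrm NE /= !scalerA -powR_mulrn ?ltW// -powRrM.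
  rewrite mulrN mulfV// powR_inv1 ?ltW// mulVf ?gt_eqF// !scale1r.
  by case: w Aw {w1 NE}.
rewrite in_itv/= => /andP[N0 N1] Aw.
exists (Num.sqrt (N w), nrm w) => /=.
  rewrite in_itv/= sqrtr_gt0 N0 -[leRHS]sqrtr1 ler_sqrt//.
  by split => //; split => //; exact: sqnorm_nrm.
rewrite !scalerA -powR12_sqrt ?ltW// -powRD; last by rewrite (gt_eqF N0) implybT.
by rewrite subrr powRr0 !scale1r; case: w {N0 N1 Aw}.
Qed.

Lemma measurable_sphere_cone A : measurable A -> measurable (sphere_cone A).
Proof.
move=> mA; rewrite sphere_coneE; apply: measurableI.
  by rewrite -[X in measurable X]setTI; apply: measurable_N => //.
by rewrite -[X in measurable X]setTI; apply: measurable_nrm => //.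
Qed.

Let surface_measure0 : surface_measure set0 = 0%E.
Proof. by rewrite /surface_measure sphere_coneE preimage_set0 setI0 measure0 mule0. Qed.

Let surface_measure_ge0 A : (0 <= surface_measure A)%E.
Proof. by rewrite /surface_measure mule_ge0. Qed.

Let surface_measure_sigma_additive : semi_sigma_additive surface_measure.
Proof.
move=> F mF tF mUF; rewrite /surface_measure.
pose mu : {measure set (Rn * Rn)%type -> \bar R} :=
  (lebesgue_measure_rV n \x lebesgue_measure_rV n)%E.
have -> : sphere_cone (\bigcup_k F k) = \bigcup_k sphere_cone (F k).
  rewrite sphere_coneE preimage_bigcup setI_bigcupr.
  by apply: eq_bigcupr => k _; rewrite sphere_coneE.
rewrite [X in X @ \oo --> _](_ : _ =
    (fun k => (2 * n%:R)%:E * \sum_(0 <= i < k) mu (sphere_cone (F i)))%E); last first.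
  by apply/funext => k; rewrite ge0_sume_distrr// => i _; exact: measure_ge0.
apply: cvgeZl => //.
apply: measure_semi_sigma_additive => [k||].
- exact: measurable_sphere_cone.
- apply/trivIsetP => i j _ _ ij; rewrite !sphere_coneE setIACA setIid.
  rewrite -preimage_setI; move/trivIsetP : tF => -> //.
  by rewrite preimage_set0 setI0.
- by apply: bigcup_measurable => k _; exact: measurable_sphere_cone.
Qed.

HB.instance Definition _ := isMeasure.Build _ _ _ surface_measure
  surface_measure0 surface_measure_ge0 surface_measure_sigma_additive.

End sphere.
Arguments sphere : clear implicits.
Arguments surface_measure : clear implicits.

Section schwartz.
Context {R : realType} (n : nat).
Local Notation Rn := 'rV[R]_n.

(* iter_partial [:: i; j; k] f is d_i d_j d_k f; sequences s of    *)
(* indices account for all multi-indices.                                     *)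
Definition iter_partial (s : seq 'I_n) (f : Rn -> R) : Rn -> R :=
  foldr (fun i h => 'D_(delta_mx ord0 i) h) f s.

Definition smooth (f : Rn -> R) :=
  forall s : seq 'I_n, continuous (iter_partial s f) /\
    forall (i : 'I_n) (x : Rn), derivable (iter_partial s f) x (delta_mx ord0 i).

Definition real_schwartz (f : Rn -> R) := smooth f /\
  forall (a : 'I_n -> nat) (s : seq 'I_n), exists M : R, forall x : Rn,
    `|(\prod_(i < n) x ord0 i ^+ a i) * iter_partial s f x| <= M.

Definition schwartz (f : Rn -> R[i]) :=
  real_schwartz (fun x => complex.Re (f x)) /\
  real_schwartz (fun x => complex.Im (f x)).

End schwartz.

Section bilinear_spherical_maximal_function.
Context {R : realType} (n : nat).
Local Notation Rn := 'rV[R]_n.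

Definition spherical_integral (F : Rn * Rn -> R[i]) : R[i] :=
  (\int[surface_measure R n]_(w in sphere R n) complex.Re (F w)) +i*
  (\int[surface_measure R n]_(w in sphere R n) complex.Im (F w)).

(* The value may a priori be +oo, hence the extended-real supremum.           *)
Definition bilinear_spherical_max (f g : Rn -> R[i]) (x : Rn) : \bar R :=
  ereal_sup [set (normc (spherical_integral
    (fun w => f (x - t *: w.1) * g (x - t *: w.2))))%:E | t in `]0, +oo[].

Definition complex_Lnorm (p : \bar R) (f : Rn -> R[i]) : \bar R :=
  'N[lebesgue_measure_rV n]_p[(fun x => (normc (f x))%:E)]%E.

Definition bilinear_spherical_max_unbounded (p1 p2 p : \bar R) : Prop :=
  ~ exists C : R, forall f g : Rn -> R[i], schwartz f -> schwartz g ->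
    ('N[lebesgue_measure_rV n]_p[bilinear_spherical_max f g] <=
      C%:E * complex_Lnorm p1 f * complex_Lnorm p2 g)%E.

End bilinear_spherical_maximal_function.

(* Main.v *)
(* Test the inequality on f = g = the Gaussian. For x with |x| large and
   t = sqrt 2 |x|, a point (y, z) of the sphere at distance O(1/t) of
   (x, x) / t contributes a constant to the integral, and such points have
   surface measure of order t^(1 - 2n). Hence M(f, f)(x) is at least of order
   |x|^(1 - 2n), which is not in L^p as soon as (2n - 1) p <= n. *)
Require Import Defs.
From mathcomp Require Import ring lra ess_sup_inf.

Set Implicit Arguments.
Unset Strict Implicit.
Unset Printing Implicit Defensive.

Import Order.TTheory GRing.Theory Num.Theory.
Import numFieldNormedType.Exports.
Import ComplexField.Normc.

Local Open Scope classical_set_scope.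
Local Open Scope ring_scope.

(** * Integration of functions not known to be measurable *)

Section integration.
Context d (T : measurableType d) (R : realType) (mu : {measure set T -> \bar R}).

(* The integral of a nonnegative function is a supremum over simple functions,
   so monotonicity holds even for f and g not known to be measurable, such as
   the maximal function. *)
Lemma ge0_le_integral_unmeasured (D : set T) (f g : T -> \bar R) :
  (forall x, D x -> (0 <= f x)%E) -> (forall x, D x -> (f x <= g x)%E) ->
  (\int[mu]_(x in D) f x <= \int[mu]_(x in D) g x)%E.
Proof.
move=> f0 fg.
have g0 x : D x -> (0 <= g x)%E by move=> Dx; exact: le_trans (f0 _ Dx) (fg _ Dx).
rewrite !ge0_integralE//; apply: le_ereal_sup => _ [h /= hf <-].
exists h => //= x; apply: le_trans (hf x) _.
by rewrite /patch; case: ifPn => // /[1!inE] /fg.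
Qed.

End integration.

(** * Product integrals and cubes in R^n *)

Section rV.
Context {R : realType}.
Local Notation mu n := (@lebesgue_measure_rV R n).

Lemma measurable_prod_coord n (f : 'I_n -> R -> R) :
  (forall i, measurable_fun setT (f i)) ->
  measurable_fun setT (fun x : 'rV[R]_n => \prod_(i < n) f i (x ord0 i)).
Proof.
move=> mf; apply: measurable_prod => i _.
exact: (measurableT_comp (mf i) (measurable_coord i)).
Qed.

(** Induction on [n]: the measure on R^(n+1) is the image of a product measure, so Tonelli splits
    off coordinate 0. This serves both volumes of cubes and the integral of the Gaussian. *)
Lemma integral_prod_coord n (f : 'I_n -> R -> R) (c : 'I_n -> R) :
  (forall i, measurable_fun setT (f i)) -> (forall i t, 0 <= f i t) ->
  (forall i, \int[lebesgue_measure]_t (f i t)%:E = (c i)%:E)%E ->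
  (\int[mu n]_x (\prod_(i < n) f i (x ord0 i))%:E = (\prod_(i < n) c i)%:E)%E.
Proof.
elim: n f c => [|n IH] f c mf f0 fc.
  under eq_integral do rewrite big_ord0.
  by rewrite big_ord0 integral_cst//= diracT mul1e.
have c0 i : 0 <= c i.
  by rewrite -lee_fin -fc; apply: integral_ge0 => t _; rewrite lee_fin.
have mF : measurable_fun setT
    (fun x : 'rV[R]_n.+1 => (\prod_(i < n.+1) f i (x ord0 i))%:E).
  by apply/measurable_EFinP; exact: measurable_prod_coord.
rewrite [LHS](ge0_integral_pushforward (@measurable_cons_rV R n) _ measurableT)//;
  last by move=> x _; rewrite lee_fin prodr_ge0.
rewrite preimage_setT fubini_tonelli1//=; last 2 first.
  exact: (measurableT_comp mF (@measurable_cons_rV R n)).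
  by move=> x; rewrite lee_fin prodr_ge0.
rewrite /fubini_F big_ord_recl.
transitivity (\int[lebesgue_measure]_t
    ((\prod_(i < n) c (lift ord0 i))%:E * (f ord0 t)%:E))%E.
  apply: eq_integral => t _ /=.
  under eq_integral => y _.
    rewrite big_ord_recl !mxE unlift_none /=.
    under eq_bigr => i _ do rewrite mxE liftK /=.
    rewrite EFinM; over.
  rewrite ge0_integralZl//=; last 3 first.
  - by apply/measurable_EFinP; exact: measurable_prod_coord (fun i => f (lift ord0 i)) _.
  - by move=> y _; rewrite lee_fin prodr_ge0.
  - by rewrite lee_fin.
  by rewrite (IH (fun i => f (lift ord0 i)) (fun i => c (lift ord0 i)))// muleC.
rewrite ge0_integralZl//=; last 3 first.
- by have := (measurable_EFinP _ (f ord0)).2 (mf ord0).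
- by move=> y _; rewrite lee_fin.
- by rewrite lee_fin prodr_ge0.
by rewrite fc -EFinM mulrC.
Qed.

(** Half-open, so that cubes sharing only a face are disjoint. *)
Definition box n (a : 'rV[R]_n) (l : R) : set 'rV[R]_n :=
  [set x | forall i, a ord0 i < x ord0 i <= a ord0 i + l].

Lemma measurable_box n (a : 'rV[R]_n) l : measurable (box a l).
Proof.
rewrite (_ : box a l = \bigcap_(i in [set: 'I_n])
   ((fun x => x ord0 i) @^-1` `]a ord0 i, a ord0 i + l])); last first.
  apply/seteqP; split=> x /= h i; first by move=> _ /=; rewrite in_itv/=; exact: h.
  by have := h i I; rewrite /= in_itv.
apply: fin_bigcap_measurable; first exact: finite_finset.
move=> i _; rewrite -[X in measurable X]setTI.
exact: measurable_coord.
Qed.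

Lemma measure_box n (a : 'rV[R]_n) l : 0 <= l -> mu n (box a l) = (l ^+ n)%:E.
Proof.
move=> l0; rewrite -[box a l]setIT -integral_indic//; last exact: measurable_box.
rewrite -[in RHS](card_ord n) -prodr_const.
rewrite -(@integral_prod_coord n (fun i => \1_(`]a ord0 i, a ord0 i + l])))//.
- apply: eq_integral => x _; congr EFin.
  have [xb|xb] := pselect (box a l x).
    rewrite indicE mem_set// big1// => i _.
    by rewrite indicE mem_set//= in_itv/= xb.
  rewrite indicE memNset//; apply/esym/eqP.
  move/existsNP: xb => [i xi]; rewrite (bigD1 i)//= indicE memNset ?mul0r//=.
- move=> i; rewrite integral_indic ?setIT//= lebesgue_measure_itv/=.
  rewrite lte_fin ltrDl -EFinB addrAC subrr add0r.
  by move: l0; rewrite le_eqVlt => /predU1P[<-|->]; rewrite ?ltxx.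
Qed.

End rV.

(** * Polynomials times Gaussians are Schwartz functions *)

Section poly_gauss.
Context {R : realType}.

(** These functions form a class closed under differentiation, which controls all derivatives of the
    Gaussian at once. *)
Definition poly_gauss (p : {poly R}) (t : R) : R := p.[t] * gauss_fun t.

Lemma is_derive_poly_gauss p (t : R) :
  is_derive t (1 : R) (poly_gauss p) (poly_gauss (p^`() - (2%:R%:P * 'X) * p) t).
Proof.
have dq : is_derive t (1 : R) (fun x : R => - x ^+ 2) (- 2 * t).
  have h := is_deriveN (is_deriveX 2 (is_derive_id t (1:R))).
  by apply: (is_derive_eq h); rewrite expr1 /= [_ *: _]mulr1 mulNr.
have dg : is_derive t (1 : R) gauss_fun (gauss_fun t * (- 2 * t)).
  exact: is_derive1_comp.
apply: (is_derive_eq (is_deriveM (is_derive_poly p t) dg)).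
rewrite /poly_gauss !hornerE /GRing.scale /=; ring.
Qed.

Lemma continuous_poly_gauss p : continuous (poly_gauss p).
Proof.
move=> t; apply: cvgM; first exact: continuous_horner.
exact: continuous_gauss_fun.
Qed.

(** For |t| <= 1 both factors are at most 1. For |t| >= 1, use exp(t^2) >= t^(2(k+1)) / (k+1)! and
    |t|^k <= |t|^(2(k+1)). *)
Lemma powM_gauss_fun_le k (t : R) : `|t| ^+ k * gauss_fun t <= (k.+1)`!%:R.
Proof.
have f1 : 1 <= (k.+1)`!%:R :> R by rewrite ler1n fact_gt0.
have [t1|/ltW t1] := leP `|t| 1.
  apply: le_trans f1; rewrite -[leRHS]mulr1 ler_pM ?exprn_ge0 ?gauss_fun_ge0 ?gauss_fun_le1//.
  by rewrite exprn_ile1.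
have /(le_trans (ler_wpDl ler01 (lexx _))) h := expR_ge1Dxn k (sqr_ge0 t).
rewrite /gauss_fun expRN ler_pdivrMr ?expR_gt0//.
move: h; rewrite ler_pdivrMr ?ltr0n ?fact_gt0// mulrC; apply: le_trans.
rewrite -real_normK ?num_real// -exprM; apply: ler_weXn2l => //.
by rewrite mul2n -addnn addSn ltnW// ltnS leq_addr.
Qed.

Lemma poly_gauss_bounded p : exists2 M : R, 0 <= M & forall t, `|poly_gauss p t| <= M.
Proof.
exists (\sum_(i < size p) `|p`_i| * (i.+1)`!%:R).
  by apply: sumr_ge0 => i _; rewrite mulr_ge0.
move=> t; rewrite /poly_gauss normrM (ger0_norm (gauss_fun_ge0 _)) horner_coef.
apply: (@le_trans _ _ (\sum_(i < size p) `|p`_i| * (`|t| ^+ i * gauss_fun t))).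
  under [leRHS]eq_bigr do rewrite mulrA -normrX -normrM.
  by rewrite -mulr_suml ler_wpM2r ?gauss_fun_ge0// ler_norm_sum.
by apply: ler_sum => i _; rewrite ler_wpM2l// powM_gauss_fun_le.
Qed.

Definition tensor_poly_gauss n (p : 'I_n -> {poly R}) (x : 'rV[R]_n) : R :=
  \prod_(i < n) poly_gauss (p i) (x ord0 i).

Lemma continuous_tensor_poly_gauss n (p : 'I_n -> {poly R}) :
  continuous (tensor_poly_gauss p).
Proof.
(* The induction needs an arbitrary list of indices in place of the full enumeration. *)
pose F s (z : 'rV[R]_n) := \prod_(i <- s) poly_gauss (p i) (z ord0 i).
rewrite (_ : tensor_poly_gauss p = F (index_enum _))//.
elim: (index_enum _) => [|i s IH].
  rewrite (_ : F [::] = cst 1); first exact: cst_continuous.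
  by apply/funext => z; rewrite /F big_nil.
rewrite (_ : F (i :: s) = fun z => poly_gauss (p i) (z ord0 i) * F s z); last first.
  by apply/funext => z; rewrite /F big_cons.
move=> x; apply: cvgM (IH x).
apply: (@continuous_comp _ _ _ (fun z : 'rV[R]_n => z ord0 i) (poly_gauss (p i))).
  exact: coord_continuous.
exact: continuous_poly_gauss.
Qed.

(** Only the factor of coordinate [i] varies, so the difference quotient is a one-variable quotient
    times the constant [c]. *)
Lemma is_derive_tensor_poly_gauss n (p : 'I_n -> {poly R}) (i : 'I_n) x :
  is_derive x (delta_mx ord0 i) (tensor_poly_gauss p)
   (tensor_poly_gauss
      (fun j => if j == i then (p j)^`() - (2%:R%:P * 'X) * p j else p j) x).
Proof.
pose c := \prod_(j < n | j != i) poly_gauss (p j) (x ord0 j).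
have [dh eh] := is_derive_poly_gauss (p i) (x ord0 i).
have E : (fun h => h^-1 *: ((tensor_poly_gauss p \o shift x)
      (h *: delta_mx ord0 i) - tensor_poly_gauss p x))
  = (fun h : R => h^-1 *: ((poly_gauss (p i) \o shift (x ord0 i)) (h *: 1)
      - poly_gauss (p i) (x ord0 i)) * c).
  apply/funext => h /=; rewrite /tensor_poly_gauss (bigD1 i)//= [in X in _ - X](bigD1 i)//=.
  rewrite -[RHS]scalerAl [in RHS]mulrBl; congr (_ *: (_ * _ - _)).
    by rewrite !mxE !eqxx.
  by apply: eq_bigr => j /negbTE ji; rewrite !mxE ji andbF mulr0 add0r.
have cv : h^-1 *: ((tensor_poly_gauss p \o shift x) (h *: delta_mx ord0 i)
      - tensor_poly_gauss p x) @[h --> 0^']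
    --> tensor_poly_gauss
      (fun j => if j == i then (p j)^`() - (2%:R%:P * 'X) * p j else p j) x.
  rewrite E /tensor_poly_gauss (bigD1 i)//= eqxx.
  rewrite (_ : \prod_(j < n | j != i) _ = c); last first.
    by apply: eq_bigr => j /negbTE ->.
  by apply: cvgMr_tmp; rewrite -eh; exact: dh.
by split; [apply/cvg_ex; eexists; exact: cv|exact/cvg_lim].
Qed.

Lemma iter_partial_tensor_poly_gauss n (p : 'I_n -> {poly R}) s :
  exists q, iter_partial s (tensor_poly_gauss p) = tensor_poly_gauss q.
Proof.
elim: s => [|i s [q /= ->]]; first by exists p.
exists (fun j => if j == i then (q j)^`() - (2%:R%:P * 'X) * q j else q j).
apply/funext => x; exact: (@derive_val _ _ _ _ _ _ _ (is_derive_tensor_poly_gauss q i x)).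
Qed.

(** Iterated partial derivatives stay in the class, and a monomial weight is absorbed into the
    polynomials, factor by factor; each factor is then bounded. *)
Lemma real_schwartz_tensor_poly_gauss n (p : 'I_n -> {poly R}) :
  real_schwartz (tensor_poly_gauss p).
Proof.
split=> [s|a s]; have [q ->] := iter_partial_tensor_poly_gauss p s.
  split; last by move=> i x; have [] := is_derive_tensor_poly_gauss q i x.
  exact: continuous_tensor_poly_gauss.
have /choice[M hM] : forall i, exists M : R,
    0 <= M /\ forall t, `|poly_gauss ('X^(a i) * q i) t| <= M.
  by move=> i; have [M] := poly_gauss_bounded ('X^(a i) * q i); exists M.
exists (\prod_(i < n) M i) => x; rewrite -big_split normr_prod; apply: ler_prod => i _.
rewrite normr_ge0 /=; have [_ /(_ (x ord0 i))] := hM i.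
by rewrite /poly_gauss hornerM hornerXn mulrA.
Qed.

End poly_gauss.

(** * A divergence test by disjoint level sets *)

Lemma integral_pinfty_of_levels d (T : measurableType d) (R : realType)
    (mu : {measure set T -> \bar R}) (q : T -> \bar R) (Q : nat -> set T)
    (v : nat -> R) (a : R) :
  (forall x, (0 <= q x)%E) -> (forall k, measurable (Q k)) -> trivIset setT Q ->
  (forall k, 0 <= v k) -> (forall k x, Q k x -> ((v k)%:E <= q x)%E) ->
  0 < a -> (forall k, (a%:E <= (v k)%:E * mu (Q k))%E) ->
  (\int[mu]_x q x)%E = +oo%E.
Proof.
move=> q0 mQ tQ v0 vq a0 av; apply/eqyP => r r0.
(* Each set contributes at least [a], so [m] of them exceed [r]. *)
pose m := (Num.truncn (r / a)).+1.
apply: (@le_trans _ _ (\sum_(k < m) (v k)%:E * mu (Q k))%E).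
  apply: (@le_trans _ _ (\sum_(k < m) a%:E)%E).
    rewrite sumEFin lee_fin sumr_const card_ord -mulr_natr mulrC -ler_pdivrMr//.
    by apply/ltW; exact: truncnS_gt.
  by apply: lee_sum => k _.
rewrite (_ : (\sum_(k < m) _)%E =
    (\int[mu]_x \sum_(k < m) ((v k)%:E * (\1_(Q k) x)%:E))%E); last first.
  rewrite ge0_integral_sum//=.
  - apply: eq_bigr => k _; rewrite ge0_integralZl//=.
    + by rewrite integral_indic// setIT.
    + by apply/measurable_EFinP; exact: measurable_indic.
    + by rewrite lee_fin.
  - by move=> k; apply/measurable_EFinP; apply: measurable_funM => //; exact: measurable_indic.
  - by move=> k x _; rewrite mule_ge0// lee_fin.
(* [q] need not be measurable: additivity was used only for the step function below it. At each
   point at most one term of that function is nonzero. *)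
apply: ge0_le_integral_unmeasured => x _.
  by apply: sume_ge0 => k _; rewrite mule_ge0// lee_fin.
have [[k Qk]|nQ] := pselect (exists k : 'I_m, Q k x); last first.
  rewrite big1// => k _; rewrite indicE memNset ?mule0//.
  by move=> Qk; apply: nQ; exists k.
rewrite (bigD1 k)//= indicE mem_set// mule1 big1 ?adde0; first exact: vq.
move=> j jk; rewrite indicE memNset ?mule0// => Qj.
by move/eqP: jk; apply; apply/val_inj/tQ => //; exists x.
Qed.

(** * Surface measure of the sphere near the direction (x, x) *)

Section geometry.
Context {R : realType}.

(** Write w_i = q_i + e_i with q = (s/t) x and 0 <= e_i <= 1/t; the q_i^2 sum to s^2/2. Two such
    blocks form a point of R^(2n) of norm close to [s]. *)
Lemma sum_sq_near n (x w : 'rV[R]_n) (s t : R) :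
  2^-1 <= s <= 3 / 4 -> 1 <= t ->
  (forall i, 0 <= x ord0 i <= t) -> \sum_(i < n) x ord0 i ^+ 2 = t ^+ 2 / 2 ->
  box ((s / t) *: x) t^-1 w ->
  s ^+ 2 / 2 <= \sum_(i < n) w ord0 i ^+ 2 <= s ^+ 2 / 2 + 5 / 2 * n%:R / t.
Proof.
move=> s12 t1 xt xS wb.
have t0 : 0 < t by lra.
have <- : \sum_(i < n) (s / t * x ord0 i) ^+ 2 = s ^+ 2 / 2.
  under eq_bigr do rewrite exprMn.
  by rewrite -mulr_sumr xS; field; rewrite gt_eqF.
have -> : 5 / 2 * n%:R / t = \sum_(i < n) (5 / 2 / t).
  by rewrite sumr_const card_ord -mulr_natr; ring.
have h i : exists u e, [/\ w ord0 i = s * u + e,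
    s / t * x ord0 i = s * u, 0 <= u <= 1 & 0 <= e <= t^-1].
  have := wb i; have := xt i; rewrite !mxE => xi wi.
  exists (x ord0 i / t), (w ord0 i - s / t * x ord0 i); split.
  - by rewrite mulrA (mulrAC s); ring.
  - by rewrite mulrA (mulrAC s).
  - by apply/andP; split; [apply: divr_ge0; lra|rewrite ler_pdivrMr// mul1r; lra].
  - by lra.
have t1' : t^-1 <= 1 by rewrite invf_le1.
have {}h i : exists q e, [/\ w ord0 i = q + e, s / t * x ord0 i = q,
    0 <= q <= 3 / 4 & 0 <= e <= t^-1].
  have [u [e [-> -> u01 e0]]] := h i; exists (s * u), e; split => //.
  by apply/andP; split; nra.
rewrite -big_split /=; apply/andP; split; apply: ler_sum => i _;
  have [q [e [-> -> q0 e0]]] := h i.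
  by nra.
(* As q <= 3/4 and e <= 1, 2qe + e^2 <= (3/2 + 1)/t, whence the 5/2. *)
have : e ^+ 2 <= t^-1 by nra.
have : q * e <= 3 / 4 * t^-1 by apply: ler_pM; lra.
by rewrite -[5 / 2 / t]/(5 / 2 * t^-1); nra.
Qed.

(** The [w] for which [x - t *: w] lies in a fixed cube of half-side 10n about 0; this size leaves
    room for the error of radial projection. *)
Definition sphere_near n (x : 'rV[R]_n) (t : R) : set 'rV[R]_n :=
  box (t^-1 *: (x - const_mx (10 * n%:R))) (20 * n%:R / t).

(** As rho + s >= 1, the bound on squares gives (rho - s) t <= 5n. Hence t w_i - rho x_i lies
    between -5n and 1, and dividing by rho >= 1/2 at most doubles this. *)
Lemma box_sub_sphere_near n (x w : 'rV[R]_n) (s t rho : R) :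
  (0 < n)%N -> 2^-1 <= s <= 3 / 4 -> 1 <= t -> (forall i, 0 <= x ord0 i <= t) ->
  s <= rho -> rho ^+ 2 <= s ^+ 2 + 5 * n%:R / t ->
  box ((s / t) *: x) t^-1 w -> sphere_near x t (rho^-1 *: w).
Proof.
move=> n0 s12 t1 xt srho rhos wb i.
have t0 : 0 < t by lra.
have r0 : 0 < rho by lra.
have n1 : 1 <= n%:R :> R by rewrite ler1n.
have := wb i; have := xt i; rewrite !mxE => xi wi.
have {}rhos : (rho - s) * t <= 5 * n%:R.
  have : rho ^+ 2 - s ^+ 2 <= 5 * n%:R / t by lra.
  rewrite ler_pdivlMr// subr_sqr => h; apply: le_trans h.
  by rewrite ler_pM2r// ler_peMr; lra.
have xr : (rho - s) * x ord0 i <= 5 * n%:R.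
  by apply: le_trans rhos; apply: ler_wpM2l; lra.
have nr : 5 * n%:R <= 10 * n%:R * rho by nra.
have wl : s * x ord0 i < w ord0 i * t by rewrite -ltr_pdivrMr// mulrAC; lra.
have wr : w ord0 i * t <= s * x ord0 i + 1.
  by rewrite -ler_pdivlMr// mulrDl mul1r mulrAC; lra.
rewrite (mulrC rho^-1) ltr_pdivlMr// ler_pdivrMr//.
rewrite (_ : t^-1 * _ + _ = t^-1 * (x ord0 i + 10 * n%:R)); last first.
  by field; rewrite gt_eqF.
rewrite -!mulrA ltr_pdivrMl// ler_pdivlMl// (mulrC t).
have : 0 <= (rho - s) * x ord0 i by apply: mulr_ge0; lra.
by move=> ?; apply/andP; split; lra.
Qed.

Lemma box_sub_sphere_cone n (x : 'rV[R]_n) (s t : R) :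
  (0 < n)%N -> 2^-1 <= s <= 3 / 4 -> 48 * n%:R <= t ->
  (forall i, 0 <= x ord0 i <= t) -> \sum_(i < n) x ord0 i ^+ 2 = t ^+ 2 / 2 ->
  box ((s / t) *: x) t^-1 `*` box ((s / t) *: x) t^-1 `<=`
  sphere_cone (sphere_near x t `*` sphere_near x t).
Proof.
move=> n0 s12 tn xt xS [u v] [/= bu bv].
have n1 : 1 <= n%:R :> R by rewrite ler1n.
have t1 : 1 <= t by lra.
(* The constant 48 ensures rho^2 <= 9/16 + 5/48 < 1, so that (u, v) lies in the unit ball. *)
have nt : n%:R / t <= 48^-1 by rewrite ler_pdivrMr; lra.
have := sum_sq_near s12 t1 xt xS bu; have := sum_sq_near s12 t1 xt xS bv.
rewrite -!mulrA; set U := \sum_(i < n) u _ _ ^+ 2; set V := \sum_(i < n) _ => hV hU.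
pose rho := Num.sqrt (U + V).
have r2 : rho ^+ 2 = U + V by rewrite sqr_sqrtr//; nra.
have sr : s <= rho.
  by rewrite -(@ler_pXn2r _ 2) ?nnegrE ?sqrtr_ge0// ?r2; lra.
have r0 : 0 < rho by lra.
have rs : rho ^+ 2 <= s ^+ 2 + 5 * n%:R / t by rewrite r2 -mulrA; lra.
exists (rho, (rho^-1 *: u, rho^-1 *: v)) => /=; last first.
  by rewrite !scalerA mulfV ?gt_eqF// !scale1r.
split; first by rewrite in_itv/= r0 -(@ler_pXn2r _ 2) ?nnegrE// ?r2 ?expr1n; nra.
split; last first.
  rewrite /sphere /sqnorm /=.
  under eq_bigr do rewrite mxE exprMn; under [X in _ + X]eq_bigr do rewrite mxE exprMn.
  by rewrite -!mulr_sumr -mulrDr -/U -/V -r2 exprVn mulVf// gt_eqF// exprn_gt0.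
by split; apply: box_sub_sphere_near rs _.
Qed.

Lemma measurable_sphere n : measurable (sphere R n).
Proof.
rewrite /sphere -[X in measurable X]setTI.
have mN : measurable_fun setT (@sqnorm R n).
  apply: measurable_funD; apply: measurable_sum => i; apply: measurable_funX.
    exact: (measurableT_comp (measurable_coord i) measurable_fst).
  exact: (measurableT_comp (measurable_coord i) measurable_snd).
exact: (mN measurableT [set 1]).
Qed.

(** The cone over this part of the sphere contains [N] disjoint cubes of volume t^(-2n). With [N] of
    order [t], the bound has order t^(1 - 2n). *)
Lemma surface_measure_sphere_near n (x : 'rV[R]_n) (t : R) (N : nat) (i0 : 'I_n) :
  48 * n%:R <= t -> 4 * N%:R <= x ord0 i0 ->
  (forall i, 0 <= x ord0 i <= t) -> \sum_(i < n) x ord0 i ^+ 2 = t ^+ 2 / 2 ->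
  ((2 * n%:R * N%:R * t ^- (2 * n))%:E <=
   surface_measure R n ((sphere_near x t `*` sphere_near x t) `&` sphere R n))%E.
Proof.
move=> tn xN xt xS.
have n0 : (0 < n)%N by exact: leq_ltn_trans (leq0n i0) (ltn_ord i0).
have n1 : 1 <= n%:R :> R by rewrite ler1n.
have t0 : 0 < t by lra.
rewrite /surface_measure.
(* With [N = 0] the coordinate [x ord0 i0] may vanish, and the step in [s] divides by it. *)
have [->|N0] := eqVneq N 0.
  by rewrite mulr0 mul0r mule_ge0// lee_fin mulr_ge0.
have x0 : 0 < x ord0 i0.
  by apply: lt_le_trans xN; rewrite mulr_gt0// ltr0n lt0n.
(* Stacking N ~ t cubes of side 1 / t along the diagonal direction (x, x): with
   this step in s, consecutive cubes share exactly one face in coordinate i0. *)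
pose s (j : nat) : R := 2^-1 + j%:R / x ord0 i0.
pose B (j : 'I_N) := box ((s j / t) *: x) t^-1 `*` box ((s j / t) *: x) t^-1.
have mB j : measurable (B j) by apply: measurableX; exact: measurable_box.
have mA : measurable (sphere_near x t) := measurable_box _ _.
have s12 (j : 'I_N) : 2^-1 <= s j <= 3 / 4.
  have : j%:R / x ord0 i0 <= 4^-1.
    rewrite ler_pdivrMr// ler_pdivlMl//; apply: le_trans xN.
    by rewrite ler_pM2l// ler_nat ltnW.
  have : 0 <= j%:R / x ord0 i0 by rewrite divr_ge0// ltW.
  by rewrite /s; lra.
rewrite -!mulrA mulrA [leLHS]EFinM; apply: lee_wpmul2l; first by rewrite lee_fin mulr_ge0.
have tB : trivIset setT B.
  apply/trivIsetP => j k _ _ jk; rewrite -subset0 => -[u v] [[/= uj _] [/= uk _]].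
  have := uj i0; have := uk i0; rewrite !mxE.
  have E (l : nat) : s l / t * x ord0 i0 = (x ord0 i0 / 2 + l%:R) / t.
    by rewrite /s; field; rewrite !gt_eqF.
  have lt_nat (a b : nat) : (x ord0 i0 / 2 + a%:R) / t < (x ord0 i0 / 2 + b%:R) / t + t^-1 ->
      (a <= b)%N.
    rewrite -[X in _ < _ + X]mul1r -mulrDl ltr_pM2r ?invr_gt0// -addrA ltrD2l.
    by rewrite natr1 ltr_nat ltnS.
  rewrite !E => /andP[k1 k2] /andP[j1 j2].
  have jk1 := lt_nat _ _ (lt_le_trans k1 j2); have kj := lt_nat _ _ (lt_le_trans j1 k2).
  by case/eqP: jk; apply/val_inj/eqP; rewrite eqn_leq jk1 kj.
apply: (@le_trans _ _ ((lebesgue_measure_rV n \x lebesgue_measure_rV n)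
   (\big[setU/set0]_(j < N) B j))%E).
  rewrite measure_bigsetU_ord//=.
  rewrite (eq_bigr (fun=> (t ^- (2 * n))%:E)) => [|j _].
    by rewrite sumEFin sumr_const card_ord mulr_natl.
  rewrite [LHS]product_measure1E; [|exact: measurable_box..].
  transitivity ((t^-1 ^+ n)%:E * (t^-1 ^+ n)%:E)%E.
    by congr (_ * _)%E; apply: measure_box; rewrite invr_ge0 ltW.
  by rewrite -EFinM -exprD addnn -mul2n exprVn.
apply: le_measure; rewrite ?inE.
- by apply: bigsetU_measurable.
- apply: measurable_sphere_cone; apply: measurableI; first exact: measurableX.
  exact: measurable_sphere.
- move=> w; rewrite -bigcup_seq => -[j _ /(box_sub_sphere_cone n0 (s12 _) tn xt xS)].
  by move=> [[r z] [r1 [Az Sz]] <-]; exists (r, z).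
Qed.

(** The cone over the sphere lies in the unit ball, hence in a cube. *)
Lemma surface_measure_sphere_lty n : (surface_measure R n (sphere R n) < +oo)%E.
Proof.
rewrite /surface_measure; apply: lte_mul_pinfty => //.
(* The cube is open on the left: starting it at -1 would lose boundary points. *)
pose b : set 'rV[R]_n := box (const_mx (- 2)) 3.
apply: (@le_lt_trans _ _ ((lebesgue_measure_rV n \x lebesgue_measure_rV n) (b `*` b))%E).
  apply: le_measure; rewrite ?inE.
  - by apply: measurable_sphere_cone; exact: measurable_sphere.
  - by apply: measurableX; exact: measurable_box.
  - move=> _ [[r [u v]] /= [+ [_ uv]] <-]; rewrite in_itv/= => /andP[r0 r1].
    have U0 (z : 'rV[R]_n) : 0 <= \sum_(j < n) z ord0 j ^+ 2.
      by apply: sumr_ge0 => j _; exact: sqr_ge0.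
    have h (z : 'rV[R]_n) : \sum_(j < n) z ord0 j ^+ 2 <= 1 -> b (r *: z).
      move=> z1 i; rewrite !mxE.
      have : z ord0 i ^+ 2 <= 1.
        by apply: le_trans z1; rewrite (bigD1 i)//= lerDl sumr_ge0// => j _; exact: sqr_ge0.
      by move=> zi; apply/andP; split; nra.
    move: uv; rewrite /sphere/= /sqnorm /= => uv; have := U0 u; have := U0 v.
    by split; apply: h; lra.
rewrite [ltLHS]product_measure1E; [|exact: measurable_box..].
have bE : (lebesgue_measure_rV n b < +oo)%E by rewrite measure_box// ltry.
by rewrite lte_mul_pinfty// ge0_fin_numE.
Qed.

End geometry.

(** * The Gaussian as test function *)

Section gaussian.
Context {R : realType}.

Definition gaussian n (x : 'rV[R]_n) : R := \prod_(i < n) gauss_fun (x ord0 i).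

Definition cgaussian n (x : 'rV[R]_n) : R[i] := (gaussian x +i* 0)%C.

Lemma gaussian_ge0 n (x : 'rV[R]_n) : 0 <= gaussian x.
Proof. by apply: prodr_ge0 => i _; exact: gauss_fun_ge0. Qed.

Lemma gaussian_gt0 n (x : 'rV[R]_n) : 0 < gaussian x.
Proof. by apply: prodr_gt0 => i _; exact: expR_gt0. Qed.

Lemma gaussian_le1 n (x : 'rV[R]_n) : gaussian x <= 1.
Proof.
apply: (@le_trans _ _ (\prod_(i < n) (1 : R))); last by rewrite big1.
by apply: ler_prod => i _; rewrite gauss_fun_ge0 gauss_fun_le1.
Qed.

Lemma schwartz_cgaussian n : (0 < n)%N -> schwartz (@cgaussian n).
Proof.
move=> n0; split.
  rewrite (_ : (fun x => _) = tensor_poly_gauss (fun=> 1)).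
    exact: real_schwartz_tensor_poly_gauss.
  apply/funext => x /=; apply: eq_bigr => i _.
  by rewrite /poly_gauss hornerE mul1r.
(* The zero imaginary part is written as a product of zero factors; [n0] enters because an empty
   product is 1. *)
rewrite (_ : (fun x => _) = tensor_poly_gauss (fun=> 0)).
  exact: real_schwartz_tensor_poly_gauss.
apply/funext => x /=; apply/esym/eqP.
by rewrite prodf_seq_eq0; apply/hasP; exists (Ordinal n0);
  rewrite ?mem_index_enum//= /poly_gauss horner0 mul0r.
Qed.

Lemma normc_cgaussian n (x : 'rV[R]_n) : normc (cgaussian x) = gaussian x.
Proof. by rewrite /= expr0n/= addr0 sqrtr_sqr ger0_norm// gaussian_ge0. Qed.

(** For finite exponents, values in ]0, 1] make the power at most the Gaussian itself, whose
    integral is sqrt(pi)^n. At infinity the bound 1 suffices. *)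
Lemma complex_Lnorm_cgaussian_lty n (p : \bar R) : (1 <= p)%E ->
  (complex_Lnorm p (@cgaussian n) < +oo)%E.
Proof.
rewrite /complex_Lnorm unlock; case: p => [r||]//; last first.
  move=> _; case: ifPn => // _; apply: (@le_lt_trans _ _ 1%E); last exact: ltry.
  apply/ess_supP/aeW => x; rewrite /comp.
  by rewrite normc_cgaussian lee_fin ger0_norm ?gaussian_ge0 ?gaussian_le1.
rewrite lee_fin => r1; apply: poweR_lty.
apply: (@le_lt_trans _ _ (\int[lebesgue_measure_rV n]_x (gaussian x)%:E)%E).
  apply: ge0_le_integral_unmeasured => x _; first exact: poweR_ge0.
  rewrite normc_cgaussian abse_EFin ger0_norm ?gaussian_ge0// poweR_EFin lee_fin.
  by rewrite ge1r_powR// gaussian_gt0 gaussian_le1.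
rewrite (@integral_prod_coord _ _ (fun=> gauss_fun) (fun=> Num.sqrt pi)) ?ltry//.
- by move=> _; exact: measurable_gauss_fun.
- by move=> _ t; exact: gauss_fun_ge0.
- by move=> _; rewrite integralT_gauss.
Qed.

Lemma gauss_fun_ge_near (t K : R) : `|t| <= K -> gauss_fun K <= gauss_fun t.
Proof.
move=> tK; rewrite /gauss_fun ler_expR lerN2 -real_normK ?num_real//.
by rewrite ler_pXn2r// nnegrE (le_trans _ tK).
Qed.

Lemma gaussian_sphere_near n (x w : 'rV[R]_n) (t : R) : 0 < t -> sphere_near x t w ->
  gauss_fun (10 * n%:R : R) ^+ n <= gaussian (x - t *: w).
Proof.
move=> t0 xw; rewrite -[in X in _ ^+ X](card_ord n) -prodr_const.
apply: ler_prod => i _; rewrite gauss_fun_ge0 gauss_fun_ge_near// ler_norml !mxE.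
have := xw i; rewrite !mxE.
rewrite (_ : t^-1 * _ + _ = t^-1 * (x ord0 i + 10 * n%:R)); last by field; rewrite gt_eqF.
by rewrite ltr_pdivrMl// ler_pdivlMl// => h; apply/andP; split; lra.
Qed.

(** One radius bounds the supremum from below. The last hypothesis places (x, x) / t on the sphere;
    near it both Gaussian factors are bounded below, and elsewhere the integrand is nonnegative. *)
Lemma bilinear_spherical_max_gaussian_ge n (x : 'rV[R]_n) (t : R) (N : nat) (i0 : 'I_n) :
  48 * n%:R <= t -> 4 * N%:R <= x ord0 i0 ->
  (forall i, 0 <= x ord0 i <= t) -> \sum_(i < n) x ord0 i ^+ 2 = t ^+ 2 / 2 ->
  (((gauss_fun (10 * n%:R : R) ^+ n) ^+ 2 * (2 * n%:R * N%:R * t ^- (2 * n)))%:E <=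
   bilinear_spherical_max (@cgaussian n) (@cgaussian n) x)%E.
Proof.
move=> tn xN xt xS.
have n0 : (0 < n)%N by exact: leq_ltn_trans (leq0n i0) (ltn_ord i0).
have n1 : 1 <= n%:R :> R by rewrite ler1n.
have t0 : 0 < t by lra.
set c := _ ^+ 2.
have c0 : 0 <= c by rewrite exprn_ge0// exprn_ge0// gauss_fun_ge0.
pose F (w : 'rV[R]_n * 'rV[R]_n) := gaussian (x - t *: w.1) * gaussian (x - t *: w.2).
have F0 w : 0 <= F w by rewrite mulr_ge0 ?gaussian_ge0.
have F1 w : F w <= 1 by rewrite mulr_ile1 ?gaussian_ge0 ?gaussian_le1.
have mS : measurable (sphere R n) by exact: measurable_sphere.
have mA : measurable (sphere_near x t `*` sphere_near x t).
  by apply: measurableX; exact: measurable_box.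
(* The maximal function uses a real-valued integral, whose default value 0 in the infinite case
   would give no lower bound. *)
have Fint : (\int[surface_measure R n]_(w in sphere R n) (F w)%:E < +oo)%E.
  apply: (@le_lt_trans _ _ (\int[surface_measure R n]_(w in sphere R n) (cst 1 w))%E).
    by apply: ge0_le_integral_unmeasured => w _; rewrite lee_fin.
  by rewrite integral_cst// mul1e surface_measure_sphere_lty.
apply: (@le_trans _ _ (\int[surface_measure R n]_(w in sphere R n) (F w)%:E)%E).
  rewrite EFinM.
  apply: (@le_trans _ _ (c%:E *
      surface_measure R n ((sphere_near x t `*` sphere_near x t) `&` sphere R n))%E).
    apply: lee_wpmul2l; first by rewrite lee_fin.
    exact: (surface_measure_sphere_near tn xN xt xS).
  rewrite -integral_indic// -ge0_integralZl//=; last first.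
    by apply/measurable_EFinP; exact: measurable_funTS (measurable_indic _).
  apply: ge0_le_integral_unmeasured => w _; first by rewrite lee_fin mulr_ge0.
  rewrite lee_fin indicE.
  have [Aw|nAw] := pselect ((sphere_near x t `*` sphere_near x t) w); last first.
    by rewrite memNset// mulr0.
  have [/= w1 w2] := Aw; rewrite mem_set// mulr1 /c expr2; apply: ler_pM;
    by rewrite ?exprn_ge0 ?gauss_fun_ge0 ?gaussian_sphere_near.
apply: ereal_sup_ubound; exists t => /=; first by rewrite in_itv/= t0.
pose G (w : 'rV[R]_n * 'rV[R]_n) := cgaussian (x - t *: w.1) * cgaussian (x - t *: w.2).
have ReG : \int[surface_measure R n]_(w in sphere R n) complex.Re (G w) =
    \int[surface_measure R n]_(w in sphere R n) F w.
  by apply: eq_Rintegral => w _ /=; rewrite mulr0 subr0.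
have ImG : \int[surface_measure R n]_(w in sphere R n) complex.Im (G w) = 0.
  rewrite (_ : (fun w => _) = cst 0) ?Rintegral_cst ?mul0r//.
  by apply/funext => w /=; rewrite mulr0 mul0r addr0.
rewrite /spherical_integral ReG ImG /= expr0n/= addr0 sqrtr_sqr.
rewrite /Rintegral ger0_norm ?fine_ge0 ?fineK//; last first.
  by apply: integral_ge0 => w _; rewrite lee_fin.
by rewrite ge0_fin_numE// integral_ge0// => w _; rewrite lee_fin.
Qed.

End gaussian.

(** * Divergence over dyadic cubes *)

Section divergence.
Context {R : realType}.

(** The factor 48n meets the lower bound required of the radius and makes a quarter of the side a
    natural number. *)
Definition dyadic_side n (k : nat) : R := (48 * n * 2 ^ k)%:R.

(** On this cube t = sqrt 2 |x| is comparable to [T] and N = T / 4 is allowed, so N t^(-2n) has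
    order T^(1 - 2n). *)
Lemma dyadic_cube_max_ge n (k : nat) (x : 'rV[R]_n) : (0 < n)%N ->
  let T := dyadic_side n k in box (const_mx T) T x ->
  ((gauss_fun (10 * n%:R : R) ^+ n ^+ 2 * (2^-1 * n%:R * (4 * n%:R) ^- (2 * n)) *
     (T / T ^+ (2 * n)))%:E <=
   bilinear_spherical_max (@cgaussian R n) (@cgaussian R n) x)%E.
Proof.
move=> n0 T xb.
have n1 : 1 <= n%:R :> R by rewrite ler1n.
have Tn : 48 * n%:R <= T.
  by rewrite -natrM ler_nat leq_pmulr// expn_gt0.
have T0 : 0 < T by lra.
have xT i : T < x ord0 i <= 2 * T by have := xb i; rewrite !mxE; lra.
pose S := \sum_(i < n) x ord0 i ^+ 2.
have xS i : x ord0 i ^+ 2 <= S.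
  by rewrite /S (bigD1 i)//= lerDl sumr_ge0// => j _; exact: sqr_ge0.
have ST : S <= 4 * n%:R * T ^+ 2.
  rewrite (_ : 4 * n%:R * T ^+ 2 = \sum_(i < n) 4 * T ^+ 2).
    by apply: ler_sum => i _; have := xT i; nra.
  by rewrite sumr_const card_ord -mulr_natr; ring.
pose i0 := Ordinal n0.
have S0 : 0 < S by apply: lt_le_trans (xS i0); have := xT i0; nra.
pose t := Num.sqrt (2 * S).
have t2 : t ^+ 2 = 2 * S by rewrite sqr_sqrtr// mulr_ge0// ltW.
have t0 : 0 < t by rewrite sqrtr_gt0 mulr_gt0.
have xt i : x ord0 i <= t.
  by rewrite -(@ler_pXn2r _ 2) ?nnegrE// ?t2; have := xT i; have := xS i; lra.
(* t^2 = 2 S <= 8 n T^2 <= 16 n^2 T^2, since n >= 1. *)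
have tT : t <= 4 * n%:R * T.
  rewrite -(@ler_pXn2r _ 2) ?nnegrE ?ltW ?mulr_gt0//; last by lra.
  have : 0 <= (n%:R - 1) * n%:R * T ^+ 2 :> R.
    by rewrite mulr_ge0 ?sqr_ge0// mulr_ge0// subr_ge0.
  by rewrite t2 !exprMn; nra.
have TN : T = 4 * (12 * n * 2 ^ k)%:R by rewrite -natrM !mulnA.
have := @bilinear_spherical_max_gaussian_ge R n x t (12 * n * 2 ^ k) i0.
move=> /(_ _ _ _ _)/(le_trans _); apply.
- rewrite lee_fin -mulrA; apply: ler_wpM2l.
    by rewrite !exprn_ge0// gauss_fun_ge0.
  rewrite (_ : _ * (T / _) = 2^-1 * n%:R * T * (4 * n%:R * T) ^- (2 * n)); last first.
    by rewrite (exprMn _ _ T) invfM; ring.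
  rewrite (_ : 2 * n%:R * (12 * n * 2 ^ k)%:R = 2^-1 * n%:R * T); last by rewrite TN; field.
  apply: ler_wpM2l; first by apply: mulr_ge0; [apply: mulr_ge0; lra|lra].
  rewrite lef_pV2 ?posrE ?exprn_gt0 ?mulr_gt0//; last lra.
  by apply: lerXn2r; rewrite // nnegrE; lra.
- by have := xT i0; have := xt i0; lra.
- by rewrite -TN; have := xT i0; lra.
- by move=> i; have := xT i; have := xt i; lra.
- by rewrite t2 mulrC mulKf.
Qed.

(** The cube ]T, 2T]^n has volume T^n and the maximal function is at least c T^(1 - 2n) on it. Each
    dyadic cube thus contributes at least c^p T^(n - (2n - 1) p) >= c^p, which forces divergence
    even at the endpoint. *)
Lemma Lnorm_max_gaussian n (p : R) : (0 < n)%N -> 0 < p ->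
  p <= n%:R / (2 * n%:R - 1) ->
  ('N[lebesgue_measure_rV n]_p%:E[
    bilinear_spherical_max (@cgaussian R n) (@cgaussian R n)] = +oo)%E.
Proof.
move=> n0 p0 pn.
have n1 : 1 <= n%:R :> R by rewrite ler1n.
rewrite unlock; apply: eqy_poweR; first by rewrite invr_gt0.
pose T := dyadic_side n.
set c := (gauss_fun (10 * n%:R : R) ^+ n ^+ 2 * (2^-1 * n%:R * (4 * n%:R) ^- (2 * n))).
have c0 : 0 < c.
  rewrite !mulr_gt0// ?exprn_gt0 ?expR_gt0 ?invr_gt0 ?exprn_gt0 ?mulr_gt0//; lra.
have T1 k : 1 <= T k :> R by rewrite ler1n !muln_gt0 n0 expn_gt0.
have T0 k : 0 < T k :> R by apply: lt_le_trans (T1 k).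
apply: (@integral_pinfty_of_levels _ _ _ _ _ (fun k => box (const_mx (T k)) (T k))
   (fun k => (c * (T k / T k ^+ (2 * n))) `^ p) (c `^ p)).
- by move=> x; exact: poweR_ge0.
- by move=> k; exact: measurable_box.
- apply: ltn_trivIset => k j jk; rewrite -subset0 => x [].
  move=> /(_ (Ordinal n0)); rewrite !mxE => /andP[_ x1] /(_ (Ordinal n0)).
  rewrite !mxE => /andP[x2 _].
  have : 2 * T j <= T k.
    by rewrite -natrM ler_nat mulnCA leq_mul2l -expnS leq_pexp2l ?orbT//.
  lra.
- by move=> k; exact: powR_ge0.
- move=> k x xb; rewrite -poweR_EFin.
  have h := dyadic_cube_max_ge n0 xb.
  have v0 : 0 <= c * (T k / T k ^+ (2 * n)).
    by rewrite mulr_ge0 ?divr_ge0 ?exprn_ge0 ?ltW.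
  apply: gt0_ler_poweR.
  + exact: ltW.
  + by rewrite in_itv/= lee_fin v0 leey.
  + by rewrite in_itv/= abse_ge0 leey.
  + by apply: le_trans h _; exact: lee_abs.
- by apply: powR_gt0.
- move=> k; rewrite [X in (_ * X)%E](_ : _ = (T k ^+ n)%:E); last first.
    by apply: measure_box; exact: ltW.
  rewrite -EFinM lee_fin powRM; [|exact: ltW|by rewrite ltW// divr_gt0// exprn_gt0].
  rewrite -mulrA ler_peMr ?powR_ge0//.
  rewrite (_ : T k / T k ^+ (2 * n) = T k `^ (1 - (2 * n)%:R)); last first.
    by rewrite powRB ?(gt_eqF (T0 k)) ?implybT// powRr1 ?powR_mulrn// (ltW (T0 k)).
  rewrite -powRrM -powR_mulrn ?(ltW (T0 k))// -powRD ?(gt_eqF (T0 k)) ?implybT//.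
  (* As T k >= 1, it remains to see that the exponent (1 - 2n) p + n is nonnegative, which is the
     upper bound on [p]. *)
  rewrite -[leLHS](powRr0 (T k)); apply: ler_powR => //.
  move: pn; rewrite ler_pdivlMr ?natrM; last lra.
  lra.
Qed.

Lemma bilinear_spherical_max_unbounded_finite n (p1 p2 : \bar R) (p : R) :
  (0 < n)%N -> (1 <= p1)%E -> (1 <= p2)%E -> 0 < p ->
  p <= n%:R / (2 * n%:R - 1) ->
  bilinear_spherical_max_unbounded n p1 p2 p%:E.
Proof.
move=> n0 p11 p21 p0 pn [C /(_ _ _ (schwartz_cgaussian n0) (schwartz_cgaussian n0))].
rewrite Lnorm_max_gaussian// leye_eq => /eqP.
have fN q : (1 <= q)%E -> complex_Lnorm q (@cgaussian R n) \is a fin_num.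
  by move=> q1; rewrite ge0_fin_numE ?Lnorm_ge0// complex_Lnorm_cgaussian_lty.
rewrite -(fineK (fN _ p11)) -(fineK (fN _ p21)) -!EFinM; discriminate.
Qed.

End divergence.

Theorem proposition7 (R : realType) :
  (forall (n : nat) (p1 p2 p : \bar R), (1 <= n)%N ->
    (1 <= p1)%E -> (1 <= p2)%E -> (p^-1 = p1^-1 + p2^-1)%E ->
    (p <= (n%:R / (2 * n%:R - 1))%:E)%E ->
    bilinear_spherical_max_unbounded n p1 p2 p) /\
  bilinear_spherical_max_unbounded 1 (2%:E : \bar R) 2%:E 1%:E.
Proof.
split; last first.
  (* This is the endpoint: n / (2n - 1) = 1 for n = 1. *)
  apply: bilinear_spherical_max_unbounded_finite; rewrite ?lee_fin ?ler1n//.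
  by rewrite mulr1 addrK divr1.
move=> n p1 p2 p n0 p11 p21 pE pn.
have ge0V (q : \bar R) : (1 <= q)%E -> (0 <= q^-1)%E.
  by move=> q1; rewrite inve_ge0 (le_trans _ q1).
have : (0 <= p^-1)%E by rewrite pE adde_ge0 ?ge0V.
(* The upper bound on [p] excludes +oo, and nonnegativity of [p^-1] excludes -oo. *)
case: p pE pn => [p||]//.
have invlt (q : \bar R) : (1 <= q)%E -> (q^-1 < +oo)%E.
  case: q => [q||]//; last by rewrite invey ltry.
  by rewrite lee_fin => q1; rewrite inver gt_eqF ?ltry// (lt_le_trans _ q1).
move=> pE pn; rewrite inve_ge0 lee_fin => p0.
apply: bilinear_spherical_max_unbounded_finite => //.
(* [p = 0] is impossible: its inverse is +oo by convention, while [p1^-1 + p2^-1] is finite. *)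
rewrite lt_neqAle p0 andbT eq_sym; apply/eqP => p00.
have : (p1^-1 + p2^-1 < +oo)%E by rewrite lte_add_pinfty ?invlt.
by rewrite -pE p00 inve0.
Qed.
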